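(* Let $(a_n)_{n\ge1}$ and $(b_n)_{n\ge1}$ be two sequences of scalars, and let $(p_n)_{n\ge1}$ and $(q_n)_{n\ge1}$ denote their respective Boolean transforms. Let $(r_n)_{n\ge1}$ denote the Boolean transform of the Hadamard product sequence $(a_nb_n)_{n\ge1}$. Then for every $n\ge1$, $$r_n=\sum_{\substack{\alpha,\beta\vDash n\\ \alpha\wedge\beta=(n)}}p_\alpha q_\beta .$$
   Context: Scalars are elements of a field. The Boolean transform of a sequence $(a_n)_{n\ge1}$ of scalars is the sequence $(b_n)_{n\ge1}$ defined by the identity of formal power series $\sum_{n\ge1}b_nx^n=1-\dfrac{1}{1+\sum_{n\ge1}a_nx^n}$. A composition of a nonnegative integer $n$, written $\alpha\vDash n$, is a sequence $\alpha=(n_1,\dots,n_k)$ of positive integers with $n_1+\cdots+n_k=n$. For a sequence $(a_n)_{n\ge1}$ and $\alpha=(n_1,\dots,n_k)$, $a_\alpha:=a_{n_1}\cdots a_{n_k}$. Compositions of $n$ are ordered by refinement: $\alpha\le\beta$ if each part of $\alpha$ is obtained by adding a number of adjacent parts of $\beta$ (in order). This is a Boolean lattice with minimum $(n)$ and maximum $(1,\dots,1)$; $\alpha\wedge\beta$ denotes the meet. (Equivalently, identifying $\alpha$ with its set of partial sums $\{n_1,n_1+n_2,\dots,n_1+\cdots+n_{k-1}\}\subseteq\{1,\dots,n-1\}$, the meet is intersection.) *)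

(* Defs.v *)
From HB Require Import structures.
From mathcomp Require Import all_boot all_order all_algebra.
Set Implicit Arguments.
Unset Strict Implicit.
Unset Printing Implicit Defensive.
Import Order.TTheory GRing.Theory.

Section Compositions.
Variable n : nat.

Record composition : Type := Composition {
  parts :> seq nat;
  _ : (0 \notin parts) && (sumn parts == n)
}.

HB.instance Definition _ := [isSub for parts].
HB.instance Definition _ := [Countable of composition by <:].

Implicit Types al be ga : composition.

Lemma parts_gt0 al : 0 \notin parts al.
Proof. by case: al => s /= /andP[]. Qed.

Lemma sumn_parts al : sumn (parts al) = n.
Proof. by case: al => s /= /andP[_ /eqP]. Qed.

End Compositions.

(* Partial sums: psums [:: n1; n2; ...] = [:: n1; n1 + n2; ...], the total
   included. *)
Definition psums (s : seq nat) : seq nat := scanl addn 0 s.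

Lemma path_scanl_addn x s : 0 \notin s -> path ltn x (scanl addn x s).
Proof.
elim: s x => //= a s IHs x; rewrite inE negb_or => /andP[a0 s0].
by rewrite -[X in X < _]addn0 ltn_add2l lt0n eq_sym a0 IHs.
Qed.

Lemma scanl_addn_gt x s y : 0 \notin s -> y \in scanl addn x s -> x < y.
Proof.
move=> s0; have := path_scanl_addn x s0.
by move/(order_path_min ltn_trans)/allP; apply.
Qed.

Lemma scanl_addn_le x s y : y \in scanl addn x s -> y <= x + sumn s.
Proof.
elim: s x => //= a s IHs x; rewrite inE => /predU1P[->|/IHs].
  by rewrite addnA leq_addr.
by rewrite addnA.
Qed.

Lemma psums_inj : injective psums.
Proof. exact: (can_inj (scanlK (f := fun x y => y - x) addKn 0)). Qed.

Lemma psums_sorted s : 0 \notin s -> sorted ltn (psums s).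
Proof. by move=> s0; apply: path_sorted (path_scanl_addn 0 s0). Qed.

Lemma mem_sumn_psums s : s != [::] -> sumn s \in psums s.
Proof.
rewrite /psums -[sumn s]add0n; elim: s 0 => //= a [|b s] IHs x _ /=.
  by rewrite addn0 inE.
by rewrite inE addnA IHs // orbT.
Qed.

(* The composition of n whose partial sums are n (if n > 0) and the
   i in {1, ..., n-1} satisfying P. *)
Definition comp_breaks (n : nat) (P : pred nat) : seq nat :=
  [seq i <- iota 1 n | (i == n) || P i].

Definition comp_seq (n : nat) (P : pred nat) : seq nat :=
  pairmap (fun x y => y - x) 0 (comp_breaks n P).

Lemma comp_breaks_path n P : path ltn 0 (comp_breaks n P).
Proof.
rewrite /comp_breaks path_min_sorted; last first.
  by apply/allP=> i; rewrite mem_filter mem_iota => /and3P[_].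
by rewrite sorted_filter ?iota_ltn_sorted //; apply: ltn_trans.
Qed.

Lemma scanl_pairmap_sub x s :
  path ltn x s -> scanl addn x (pairmap (fun x y => y - x) x s) = s.
Proof. by elim: s x => //= y s IHs x /andP[xy /IHs]; rewrite subnKC ?(ltnW xy)// => ->. Qed.

Lemma psums_comp_seq n P : psums (comp_seq n P) = comp_breaks n P.
Proof. by rewrite /psums scanl_pairmap_sub ?comp_breaks_path. Qed.

Lemma sumn_pairmap_sub x s : path ltn x s ->
  x + sumn (pairmap (fun x y => y - x) x s) = last x s.
Proof.
elim: s x => [|y s IHs] x /=; first by rewrite addn0.
by case/andP=> xy /IHs <-; rewrite addnA subnKC // ltnW.
Qed.

Lemma pairmap_sub_gt0 x s :
  path ltn x s -> 0 \notin pairmap (fun x y => y - x) x s.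
Proof.
elim: s x => //= y s IHs x /andP[xy /IHs ys0].
by rewrite inE negb_or ys0 eq_sym subn_eq0 -ltnNge xy.
Qed.

Lemma comp_seqP n P : (0 \notin comp_seq n P) && (sumn (comp_seq n P) == n).
Proof.
apply/andP; split.
  exact/pairmap_sub_gt0/comp_breaks_path.
rewrite -[sumn _]add0n sumn_pairmap_sub ?comp_breaks_path //.
case: n => // n; rewrite /comp_breaks -addn1 iotaD filter_cat last_cat /=.
by rewrite add1n addn1 eqxx.
Qed.

Definition comp_of (n : nat) (P : pred nat) : composition n :=
  Composition (comp_seqP n P).

Section PartialSums.
Variable n : nat.
Implicit Types al be ga : composition n.


Lemma psums_bounds al i : i \in psums al -> 0 < i <= n.
Proof.
move=> i_al; rewrite (scanl_addn_gt (parts_gt0 al) i_al) /=.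
by have := scanl_addn_le i_al; rewrite sumn_parts.
Qed.

Lemma mem_n_psums al : 0 < n -> n \in psums al.
Proof.
move=> n0; rewrite -{1}(sumn_parts al) mem_sumn_psums //.
by apply/eqP=> al0; move: (sumn_parts al) n0; rewrite al0 /= => <-.
Qed.

Lemma mem_psums_comp_of P i :
  (i \in psums (comp_of n P)) = (0 < i <= n) && ((i == n) || P i).
Proof. by rewrite /= psums_comp_seq mem_filter mem_iota add1n ltnS andbC. Qed.

Lemma psums_eq al be : psums al =i psums be -> al = be.
Proof.
move=> eq_ab; apply/val_inj/psums_inj.
by apply: (irr_sorted_eq ltn_trans ltnn) => //; apply/psums_sorted/parts_gt0.
Qed.

Definition comp_set al : {set 'I_n.+1} := [set i | val i \in psums al].

Lemma comp_setK :
  cancel comp_set (fun D => comp_of n (fun i => inord i \in D)).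
Proof.
move=> al; apply: psums_eq => i; rewrite mem_psums_comp_of.
apply/idP/idP => [/andP[/andP[i0 le_in]]|i_al].
  rewrite inE /= inordK ?ltnS // => /predU1P[i_n|//].
  by rewrite i_n mem_n_psums // -i_n.
have /andP[-> le_in] := psums_bounds i_al.
by rewrite le_in inE /= inordK ?ltnS // i_al orbT.
Qed.

HB.instance Definition _ : isFinite (composition n) := CanIsFinite comp_setK.

End PartialSums.

Section CompositionOrder.
Variable n : nat.
Implicit Types al be ga : composition n.

(* Cutting be into consecutive nonempty blocks amounts to choosing the block
   lengths sh, a composition of the number of parts of be. *)
Definition refinement al be : bool :=
  [exists sh : composition (size be),
     parts al == [seq sumn s | s <- reshape sh be]].

Lemma group_sub (ss : seq (seq nat)) x : [::] \notin ss ->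
  {subset scanl addn x (map sumn ss) <= scanl addn x (flatten ss)}.
Proof.
elim: ss x => //= s ss IHss x; rewrite inE negb_or => /andP[s0 ss0] i.
rewrite scanl_cat mem_cat inE => /predU1P[->|i_ss]; apply/orP.
  left; elim: s x s0 {IHss} => //= a [|b s] IHs x _; first by rewrite addn0 inE.
  by rewrite inE addnA IHs // orbT.
right; suff ->: foldl addn x s = x + sumn s by exact: IHss.
by elim: s x {s0 IHss i_ss} => [|a s IHs] x /=; rewrite ?addn0 // IHs addnA.
Qed.

Lemma sub_group (s t : seq nat) x : 0 \notin s -> 0 \notin t ->
    sumn s = sumn t -> {subset scanl addn x s <= scanl addn x t} ->
  exists ss : seq (seq nat),
    [/\ [::] \notin ss, flatten ss = t & map sumn ss = s].
Proof.
elim: t s x => [|b t IHt] [|a s] x.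
- by exists [::].
- by rewrite inE negb_or /=; case: a.
- by rewrite inE negb_or /=; case: b.
rewrite !inE !negb_or => /andP[a0 s0] /andP[b0 t0] /= eq_st sub_st.
have sub_t i : x + b < i -> i \in scanl addn (x + a) s ->
    i \in scanl addn (x + b) t.
  move=> lt_i i_s; have := sub_st i; rewrite !inE i_s orbT.
  by move=> /(_ isT) /predU1P[i_xb|//]; rewrite i_xb ltnn in lt_i.
case: (ltngtP a b) => [lt_ab|lt_ba|eq_ab].
- have := sub_st (x + a); rewrite !inE eqxx => /(_ isT) /predU1P[/addnI eq_ab|].
    by rewrite eq_ab ltnn in lt_ab.
  by move/(scanl_addn_gt t0); rewrite ltn_add2l ltnNge (ltnW lt_ab).
- have [||||ss [ss0 ss_t ss_s]] := IHt ((a - b) :: s) (x + b).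
  + by rewrite inE negb_or eq_sym subn_eq0 -ltnNge lt_ba.
  + by [].
  + by apply: (@addnI b); rewrite /= addnA subnKC // ltnW.
  + move=> i; rewrite /= -addnA subnKC ?(ltnW lt_ba) // => i_s.
    have lt_i : x + b < i.
      move: i_s; rewrite inE => /predU1P[->|/(scanl_addn_gt s0)].
        by rewrite ltn_add2l.
      by apply: leq_ltn_trans; rewrite leq_add2l ltnW.
    have := sub_st i; rewrite !inE -in_cons i_s => /(_ isT) /predU1P[i_xb|//].
    by rewrite i_xb ltnn in lt_i.
  case: ss ss0 ss_t ss_s => // s1 ss; rewrite inE negb_or => /andP[_ ss0] /= ss_t.
  case=> s1_ab ss_s; exists ((b :: s1) :: ss).
  by split; rewrite ?inE //= ?ss_t // s1_ab ss_s subnKC // ltnW.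
have [||||ss [ss0 ss_t ss_s]] := IHt s (x + b) => //.
- by move: eq_st; rewrite eq_ab => /addnI.
- move=> i i_s; rewrite sub_t //; first exact: (scanl_addn_gt s0 i_s).
  by rewrite eq_ab.
by exists ([:: b] :: ss); split; rewrite ?inE //= ?ss_t // addn0 eq_ab ss_s.
Qed.

Lemma refinementP al be :
  reflect {subset psums al <= psums be} (refinement al be).
Proof.
apply: (iffP existsP) => [[sh /eqP al_sh]|sub_ab].
  have ss0 : [::] \notin reshape sh be.
    apply: contra (parts_gt0 sh) => nil_in.
    by have := map_f size nil_in; rewrite -/(shape _) reshapeKl ?sumn_parts.
  move: (group_sub (x := 0) ss0).
  by rewrite reshapeKr ?sumn_parts // -al_sh.
have [||||ss [ss0 ss_b ss_a]] := @sub_group al be 0; rewrite ?parts_gt0 //.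
  by rewrite !sumn_parts.
have shP : (0 \notin shape ss) && (sumn (shape ss) == size be).
  rewrite -ss_b size_flatten eqxx andbT; apply: contra ss0.
  by case/mapP=> s s_ss /esym/size0nil <-.
by exists (Composition shP); rewrite /= -ss_b flattenK ss_a.
Qed.

Fact refinement_refl : reflexive refinement.
Proof. by move=> al; apply/refinementP. Qed.

Fact refinement_anti : antisymmetric refinement.
Proof.
move=> al be /andP[/refinementP ab /refinementP ba]; apply: psums_eq => i.
by apply/idP/idP => [/ab|/ba].
Qed.

Fact refinement_trans : transitive refinement.
Proof.
move=> be al ga /refinementP ab /refinementP bc; apply/refinementP => i.
by move/ab/bc.
Qed.

End CompositionOrder.

Fact refinement_display : Order.disp_t.
Proof. exact: Order.Disp tt tt. Qed.

HB.instance Definition _ n := Order.Le_isPOrder.Build refinement_display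
  (composition n) (@refinement_refl n) (@refinement_anti n) (@refinement_trans n).

Definition comp_meet n (al be : composition n) : composition n :=
  comp_of n [pred i | (i \in psums al) && (i \in psums be)].

Fact comp_meetP n (al be ga : composition n) :
  (al <= comp_meet be ga)%O = (al <= be)%O && (al <= ga)%O.
Proof.
apply/refinementP/andP => [sub|[/refinementP ab /refinementP ac] i i_al].
  by split; apply/refinementP => i /sub; rewrite mem_psums_comp_of;
    case/andP=> /andP[i0 _] /predU1P[i_n|/andP[]//]; rewrite i_n mem_n_psums -?i_n.
by rewrite mem_psums_comp_of (psums_bounds i_al) /= ab ?ac ?orbT.
Qed.

HB.instance Definition _ n := Order.POrder_isMeetSemilattice.Build
  refinement_display (composition n) (@comp_meetP n).

Local Open Scope ring_scope.

Section BooleanTransform.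
Variable K : fieldType.
Implicit Types (a b : nat -> K) (f g : nat -> K).

(* A formal power series is the function giving its coefficients. *)
Definition fps_one : nat -> K := fun n => (n == 0%N)%:R.

Definition fps_mul f g : nat -> K := fun n => \sum_(i < n.+1) f i * g (n - i)%N.

(* The series sum_(n >= 1) a_n x^n; a scalar sequence (a_n) with n >= 1 is a
   function on nat whose value at 0 is irrelevant. *)
Definition fps_of_seq a : nat -> K := fun n => if n is 0%N then 0 else a n.

(* The series g is 1 / (1 + sum_(n >= 1) a_n x^n). *)
Definition is_boolean_transform a b : Prop :=
  exists2 g : nat -> K,
    fps_mul (fps_one \+ fps_of_seq a) g =1 fps_one
    & fps_of_seq b =1 fps_one \- g.

Lemma fps_inv_exists f : f 0%N = 1 -> exists g, fps_mul f g =1 fps_one.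
Proof.
move=> f0; pose step (s : seq K) :=
  fps_one (size s) - \sum_(i < size s) f i.+1 * s`_(size s - i.+1).
pose pre n := iter n (fun s => rcons s (step s)) [::].
have sz n : size (pre n) = n by elim: n => //= n IHn; rewrite size_rcons IHn.
have pre_nth m n : (m < n)%N -> (pre n)`_m = step (pre m).
  elim: n => // n IHn; rewrite ltnS /= nth_rcons sz => le_mn.
  by case: (ltngtP m n) le_mn => // [/IHn //|-> _].
exists (fun n => step (pre n)) => n; rewrite /fps_mul big_ord_recl f0 mul1r subn0.
rewrite {1}/step sz; set S := (X in _ - X); rewrite -[RHS](subrK S).
congr (_ + _); apply: eq_bigr => i _; rewrite pre_nth //.
by rewrite ltn_subrL (leq_ltn_trans _ (ltn_ord i)).
Qed.

Lemma fps_inv_uniq f g h : f 0%N = 1 -> fps_mul f g =1 fps_mul f h -> g =1 h.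
Proof.
move=> f0 eq_gh n; elim/ltn_ind: n => n IHn.
have := eq_gh n; rewrite /fps_mul !big_ord_recl f0 !mul1r subn0.
rewrite [X in _ + X = _](eq_bigr (fun i : 'I_n => f (lift ord0 i) * h (n - lift ord0 i)%N)).
  by move/addIr.
move=> i _; rewrite IHn // ltn_subrL (leq_ltn_trans _ (ltn_ord i)) //.
Qed.

Lemma one_add_fps0 a : (fps_one \+ fps_of_seq a) 0%N = 1.
Proof. by rewrite /= addr0. Qed.

Lemma boolean_transform_exists a : exists b, is_boolean_transform a b.
Proof.
have [g fg] := fps_inv_exists (one_add_fps0 a).
exists (fps_one \- g), g => // -[|n] //=.
have := fg 0%N; rewrite /fps_mul big_ord1 one_add_fps0 mul1r => ->.
by rewrite subrr.
Qed.

Lemma boolean_transform_uniq a b c :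
  is_boolean_transform a b -> is_boolean_transform a c ->
  forall n, (0 < n)%N -> b n = c n.
Proof.
case=> g fg bg [h fh ch] [//|n] _.
have gh : g =1 h.
  by apply: (fps_inv_uniq (one_add_fps0 a)) => m; rewrite fg fh.
by have := bg n.+1; have := ch n.+1; rewrite /= gh => -> ->.
Qed.

Definition comp_prod (p : nat -> K) n (al : composition n) : K :=
  \prod_(i <- al) p i.

End BooleanTransform.

(* Main.v *)
Require Import Defs.
From mathcomp Require Import all_boot all_order all_algebra.
Import GRing.Theory.
Local Open Scope ring_scope.

(** Clearing denominators, [b] is the Boolean transform of [a] exactly when
    [a_n = \sum_(1 <= k <= n) b_k a_(n - k)] with the convention [a_0 = 1]
    ([boolean_transform_recurrence]). Decomposing a composition of [n] by its
    first part shows that [\sum_(al |= n) p_al] satisfies this recurrence, so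
    it equals [a_n] as soon as [p] is the Boolean transform of [a]
    ([sum_comp_prodE]).

    Hence [a_n b_n] is the sum of [p_al q_be] over all pairs of compositions of
    [n]. Decompose the pairs by the first part [k] of the meet, that is, by the
    first partial sum common to [al] and [be]. Both compositions break at [k],
    and the pair is the concatenation of a pair of compositions of [k] whose
    meet is [(k)] and of an arbitrary pair of compositions of [n - k], because
    meet commutes with concatenation ([comp_cat_meet]). This gives the
    recurrence above for the sequence [a_n b_n] with the right-hand side of the
    theorem in the role of its Boolean transform, and Boolean transforms are
    unique. *)

(** * Concatenation of compositions *)

Section Concatenation.
Set Implicit Arguments.
Unset Strict Implicit.
Unset Printing Implicit Defensive.
Local Open Scope nat_scope.

Lemma mem_psums_cat (s t : seq nat) i : 0 \notin t ->
  (i \in psums (s ++ t)) =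
    (i \in psums s) || (sumn s < i) && (i - sumn s \in psums t).
Proof.
have shift x y (u : seq nat) : scanl addn (x + y) u = map (addn x) (scanl addn y u).
  by elim: u y => //= z u IHu y; rewrite -addnA IHu.
have foldlE x (u : seq nat) : foldl addn x u = x + sumn u.
  by elim: u x => [|z u IHu] x /=; rewrite ?addn0 // IHu addnA.
move=> t0; rewrite /psums scanl_cat mem_cat foldlE add0n -[in LHS](addn0 (sumn s)) shift.
congr (_ || _); apply/mapP/andP => [[j j_t ->]|[lt_i i_t]].
  by rewrite addKn -[X in X < _]addn0 ltn_add2l (scanl_addn_gt t0 j_t).
by exists (i - sumn s); rewrite ?subnKC // ltnW.
Qed.

Lemma comp_catP k m (b : composition k) (c : composition m) :
  (0 \notin parts b ++ parts c) && (sumn (parts b ++ parts c) == k + m).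
Proof. by rewrite mem_cat negb_or !parts_gt0 sumn_cat !sumn_parts eqxx. Qed.

Definition comp_cat k m (b : composition k) (c : composition m) :
  composition (k + m) := Composition (comp_catP b c).

Lemma mem_psums_comp_cat k m (b : composition k) (c : composition m) i :
  (i \in psums (comp_cat b c)) =
    (i \in psums b) || (k < i) && (i - k \in psums c).
Proof. by rewrite mem_psums_cat ?parts_gt0 // sumn_parts. Qed.

Lemma psums_comp_cat_le k m (b : composition k) (c : composition m) i :
  i <= k -> (i \in psums (comp_cat b c)) = (i \in psums b).
Proof. by move=> le_ik; rewrite mem_psums_comp_cat ltnNge le_ik orbF. Qed.

Lemma psums_comp_cat_gt k m (b : composition k) (c : composition m) i :
  0 < i -> (k + i \in psums (comp_cat b c)) = (i \in psums c).
Proof.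
move=> i0; have lt_k : k < k + i by rewrite -[X in X < _]addn0 ltn_add2l.
rewrite mem_psums_comp_cat addKn lt_k /=; case: (boolP (k + i \in _)) => //.
by case/psums_bounds/andP=> _; rewrite leqNgt lt_k.
Qed.

(** The two factors into which a composition of [k + m] that breaks at [k]
    splits. *)
Definition comp_left k m (al : composition (k + m)) : composition k :=
  comp_of k (fun i => i \in psums al).
Definition comp_right k m (al : composition (k + m)) : composition m :=
  comp_of m (fun i => k + i \in psums al).

Lemma comp_catKl k m (b : composition k) (c : composition m) :
  comp_left (comp_cat b c) = b.
Proof.
apply: psums_eq => i; rewrite mem_psums_comp_of /=.
apply/andP/idP => [[/andP[i0 le_ik]]|i_b].
  case/predU1P=> [i_k|]; first by rewrite i_k mem_n_psums // -i_k.
  by rewrite psums_comp_cat_le.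
by have /andP[i0 le_ik] := psums_bounds i_b; rewrite psums_comp_cat_le // i0 le_ik i_b orbT.
Qed.

Lemma comp_catKr k m (b : composition k) (c : composition m) :
  comp_right (comp_cat b c) = c.
Proof.
apply: psums_eq => i; rewrite mem_psums_comp_of /=.
apply/andP/idP => [[/andP[i0 le_im]]|i_c].
  case/predU1P=> [i_m|]; first by rewrite i_m mem_n_psums // -i_m.
  by rewrite psums_comp_cat_gt.
by have /andP[i0 le_im] := psums_bounds i_c; rewrite psums_comp_cat_gt // i0 le_im i_c orbT.
Qed.

Lemma comp_cat_split k m (al : composition (k + m)) :
  k \in psums al -> comp_cat (comp_left al) (comp_right al) = al.
Proof.
move=> k_al; apply: psums_eq => i; rewrite mem_psums_comp_cat !mem_psums_comp_of.
case: (leqP i k) => [le_ik|lt_ki] /=.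
  rewrite andbT orbF; apply/andP/idP => [[i0 /predU1P[->//|//]]|i_al].
  by have /andP[-> _] := psums_bounds i_al; rewrite i_al orbT.
rewrite andbF /= subn_gt0 lt_ki /= leq_subLR subnKC ?(ltnW lt_ki) //.
apply/andP/idP => [[le_i /predU1P[i_m|//]]|i_al].
  by rewrite -(subnKC (ltnW lt_ki)) i_m mem_n_psums // addn_gt0 -i_m subn_gt0 lt_ki orbT.
by have /andP[_ ->] := psums_bounds i_al; rewrite i_al orbT.
Qed.

Lemma mem_psums_meet n (al be : composition n) i :
  (i \in psums (al `&` be)%O) = (i \in psums al) && (i \in psums be).
Proof.
rewrite mem_psums_comp_of /=; apply/andP/andP => [[/andP[i0 _]]|[i_al i_be]].
  case/predU1P=> [i_n|/andP[//]].
  by rewrite i_n !mem_n_psums // -i_n.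
by rewrite (psums_bounds i_al) i_al i_be orbT.
Qed.

(** Meet intersects sets of partial sums. Those of a concatenation that are at
    most [k] come from its left factor and the others, shifted by [k], from its
    right factor, so the intersection can be taken factor by factor. *)
Lemma comp_cat_meet k m (b b' : composition k) (c c' : composition m) :
  (comp_cat b c `&` comp_cat b' c')%O =
    comp_cat (b `&` b')%O (c `&` c')%O.
Proof.
apply: psums_eq => i; case: (leqP i k) => [le_ik|lt_ki].
  by rewrite mem_psums_meet !psums_comp_cat_le // mem_psums_meet.
rewrite mem_psums_meet -(subnKC (ltnW lt_ki)).
by rewrite !psums_comp_cat_gt ?subn_gt0 // mem_psums_meet.
Qed.

(** * First parts *)

Lemma head_comp_bounds n (al : composition n) : 0 < n -> 0 < head 0 al <= n.
Proof.
move=> n0; have := parts_gt0 al; have := sumn_parts al.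
case: (parts al) => [|x s] /= sum_s; first by rewrite -sum_s in n0.
by rewrite inE negb_or lt0n eq_sym => /andP[-> _]; rewrite -sum_s leq_addr.
Qed.

Lemma head_comp_eq n (al : composition n) : 0 < n ->
  (head 0 al == n) = (parts al == [:: n]).
Proof.
move=> n0; apply/eqP/eqP => [|-> //].
have := parts_gt0 al; have := sumn_parts al.
case: (parts al) => [|x s] /= sum_s; first by rewrite -sum_s in n0.
rewrite inE negb_or => /andP[_ s0] x_n; move: sum_s s0; rewrite x_n.
rewrite -[RHS]addn0 => /addnI; case: s => // y s /= /eqP.
by rewrite addn_eq0 inE negb_or => /andP[/eqP->].
Qed.

Lemma head_mem_psums n (al : composition n) : 0 < n -> head 0 al \in psums al.
Proof.
move/(head_comp_bounds al); case: (parts al) => //= x s _.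
by rewrite inE add0n eqxx.
Qed.

Lemma head_comp_cat k m (b : composition k) (c : composition m) : 0 < k ->
  head 0 (comp_cat b c) = head 0 b.
Proof. by move/(head_comp_bounds b) => /=; case: (parts b). Qed.

End Concatenation.

(** * Sums over compositions *)

Section Sums.
Set Implicit Arguments.
Unset Strict Implicit.
Unset Printing Implicit Defensive.
Context {K : fieldType}.
Implicit Types (a b p q : nat -> K) (k m n : nat).

(** Concatenation is a bijection onto the compositions that break at [k].
    The support of [F] carries this restriction, so that [F] may include any
    stronger condition on the first part. *)
Lemma sum_comp_cat k m (F : composition (k + m) -> K) : (0 < k)%N ->
    (forall al : composition (k + m), k \notin psums al -> F al = 0) ->
  \sum_al F al = \sum_(b : composition k) \sum_(c : composition m) F (comp_cat b c).
Proof.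
move=> k0 F0; rewrite (bigID (fun al : composition _ => k \in psums al)) /=.
rewrite [X in _ + X]big1 ?addr0; last by move=> al /F0.
rewrite pair_big (reindex (fun bc : composition k * composition m => comp_cat bc.1 bc.2)) /=.
  apply: eq_bigl => -[b c].
  by rewrite psums_comp_cat_le ?mem_n_psums.
exists (fun al => (comp_left al, comp_right al)) => [[b c] _|al].
  by rewrite comp_catKl comp_catKr.
exact: comp_cat_split.
Qed.

Lemma sum_by_value n (I : finType) (P : pred I) (h : I -> nat) (F : I -> K) :
    (forall i, 0 < h i <= n)%N ->
  \sum_(i | P i) F i = \sum_(k < n) \sum_(i | P i && (h i == k.+1)) F i.
Proof.
move=> h_n; rewrite (exchange_big_dep P) /=; last by move=> k i _ /andP[].
apply: eq_bigr => i Pi; have /andP[h0 hn] := h_n i.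
have lt_h : ((h i).-1 < n)%N by case: (h i) h0 hn.
rewrite (big_pred1 (Ordinal lt_h)) // => k.
by rewrite Pi /= -val_eqE /= -[in RHS]eqSS prednK // eq_sym.
Qed.

Lemma comp_prod_cat p k m (b : composition k) (c : composition m) :
  comp_prod p (comp_cat b c) = comp_prod p b * comp_prod p c.
Proof. exact: big_cat. Qed.

Definition sum_comp_prod p n : K := \sum_(al : composition n) comp_prod p al.

Definition sum_trivial_meet p q n : K :=
  \sum_(al : composition n)
    \sum_(be : composition n | parts (al `&` be)%O == [:: n])
       comp_prod p al * comp_prod q be.

Lemma comp_singleP k : (0 \notin [:: k.+1]) && (sumn [:: k.+1] == k.+1).
Proof. by rewrite /= addn0 eqxx. Qed.

Lemma sum_comp_prod0 p : sum_comp_prod p 0 = 1.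
Proof.
have nilP : (0 \notin Nil nat) && (sumn [::] == 0)%N by [].
rewrite /sum_comp_prod (big_pred1 (Composition nilP)) /comp_prod ?big_nil //.
move=> al /=; apply/esym/eqP/val_inj => /=.
have := parts_gt0 al; have := sumn_parts al.
by case: (parts al) => //= -[].
Qed.

Lemma sum_comp_prod_head p k m :
  \sum_(al : composition (k.+1 + m) | head 0%N al == k.+1) comp_prod p al =
    p k.+1 * sum_comp_prod p m.
Proof.
rewrite big_mkcond sum_comp_cat //=; last first.
  move=> al k_al; case: eqP => // hk; move: k_al.
  by rewrite -[in X in X \notin _]hk head_mem_psums.
(* The only left factor with first part [k.+1] is the one-part composition. *)
rewrite (bigD1 (Composition (comp_singleP k))) //= [X in _ + X]big1 ?addr0.
  rewrite /sum_comp_prod mulr_sumr; apply: eq_bigr => c _.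
  by rewrite eqxx comp_prod_cat /comp_prod /= big_seq1.
move=> b neq_b; apply: big1 => c _.
rewrite -/(comp_cat b c) head_comp_cat // head_comp_eq //; case: eqP => // b_k.
by case/eqP: neq_b; apply: val_inj.
Qed.

Lemma sum_comp_prodS p n :
  sum_comp_prod p n.+1 = \sum_(k < n.+1) p k.+1 * sum_comp_prod p (n - k).
Proof.
rewrite /sum_comp_prod (@sum_by_value n.+1 _ _ (fun al : composition _ => head 0%N al)).
  apply: eq_bigr => -[k /= lt_k] _; rewrite -/(sum_comp_prod p _).
  by rewrite -sum_comp_prod_head addSn subnKC.
by move=> al; apply: head_comp_bounds.
Qed.

(** A pair whose meet starts with [k.+1] is the concatenation of a pair of
    compositions of [k.+1] with trivial meet and of an arbitrary pair. *)
Lemma sum_meet_head p q k m :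
  \sum_(al : composition (k.+1 + m))
    \sum_(be : composition (k.+1 + m) | head 0%N (al `&` be)%O == k.+1)
       comp_prod p al * comp_prod q be =
  sum_trivial_meet p q k.+1 * (sum_comp_prod p m * sum_comp_prod q m).
Proof.
have breaks (al be : composition (k.+1 + m)) :
    head 0%N (al `&` be)%O = k.+1 -> (k.+1 \in psums al) && (k.+1 \in psums be).
  by move=> hk; rewrite -mem_psums_meet -[in X in X \in _]hk head_mem_psums.
rewrite sum_comp_cat //; last first.
  move=> al k_al; apply: big1 => be /eqP/breaks/andP[].
  by rewrite (negPf k_al).
rewrite /sum_trivial_meet mulr_suml; apply: eq_bigr => b _.
(* Split the second composition as well; the condition on the meet bears only
   on the left factors, and the products separate. *)
transitivity (\sum_(c : composition m)
    \sum_(b' : composition k.+1 | parts (b `&` b')%O == [:: k.+1])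
    \sum_(c' : composition m)
    (comp_prod p b * comp_prod q b') * (comp_prod p c * comp_prod q c')).
  apply: eq_bigr => c _; rewrite big_mkcond sum_comp_cat //; last first.
    move=> be k_be; case: eqP => // /breaks/andP[_].
    by rewrite (negPf k_be).
  rewrite [RHS]big_mkcond; apply: eq_bigr => b' _.
  transitivity (\sum_(c' : composition m) if parts (b `&` b')%O == [:: k.+1]
      then (comp_prod p b * comp_prod q b') * (comp_prod p c * comp_prod q c') else 0).
    apply: eq_bigr => c' _.
    by rewrite comp_cat_meet head_comp_cat // head_comp_eq // !comp_prod_cat mulrACA.
  by case: ifP => // _; rewrite big1.
rewrite exchange_big mulr_suml; apply: eq_bigr => b' _.
rewrite /sum_comp_prod big_distrlr mulr_sumr; apply: eq_bigr => c _.
by rewrite mulr_sumr.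
Qed.

Lemma sum_comp_prodM p q n :
  sum_comp_prod p n.+1 * sum_comp_prod q n.+1 =
    \sum_(k < n.+1) sum_trivial_meet p q k.+1 *
      (sum_comp_prod p (n - k) * sum_comp_prod q (n - k)).
Proof.
rewrite [in LHS]/sum_comp_prod big_distrlr /=.
under eq_bigr => al _.
  rewrite (@sum_by_value n.+1 _ _ (fun be => head 0%N (al `&` be)%O)); last first.
    by move=> be; apply: head_comp_bounds.
  over.
rewrite exchange_big; apply: eq_bigr => -[k /= lt_k] _.
by rewrite -sum_meet_head addSn subnKC.
Qed.

(** * Boolean transforms *)

(** The coefficient of [x^(n+1)] in [(1 + A)(1 - B) = 1]. *)
Lemma boolean_transform_recurrence a b :
  is_boolean_transform a b <->
  forall n, a n.+1 = \sum_(k < n.+1) b k.+1 * (fps_one K \+ fps_of_seq a) (n - k)%N.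
Proof.
set A := fps_one K \+ fps_of_seq a.
have A0 : A 0%N = 1 by exact: one_add_fps0.
have AS n : A n.+1 = a n.+1 by rewrite /A /fps_one /= add0r.
have mulE g n : fps_mul A g n.+1 = g 0%N * a n.+1 + \sum_(k < n.+1) g k.+1 * A (n - k)%N.
  rewrite /fps_mul (reindex_inj rev_ord_inj) /= big_ord_recl /= subSS subn0 subnn AS mulrC.
  congr (_ + _); apply: eq_bigr => k _.
  have -> : bump 0 k = k.+1 by [].
  by rewrite subSS (subKn (ltn_ord k)) subSS mulrC.
split=> [[g Ag bg] n|rec].
  rewrite -/A in Ag.
  have g0 : g 0%N = 1 by have := Ag 0%N; rewrite /fps_mul big_ord1 A0 mul1r.
  have gS k : g k.+1 = - b k.+1.
    by have := bg k.+1; rewrite /fps_one /= sub0r => ->; rewrite opprK.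
  have := Ag n.+1; rewrite mulE g0 mul1r /fps_one /=.
  under eq_bigr => k _ do rewrite gS mulNr.
  by rewrite sumrN => /eqP; rewrite subr_eq0 => /eqP.
(* Here [1 / (1 + A)] is [1 - B]. *)
exists (fps_one K \- fps_of_seq b) => [[|n]|n]; rewrite -/A.
- by rewrite /fps_mul big_ord1 A0 mul1r /= subr0.
- rewrite mulE /= subr0 mul1r [in LHS]rec -big_split big1 //= => k _.
  by rewrite /fps_one /= sub0r mulNr addrN.
- by rewrite /= opprB addrC subrK.
Qed.

Lemma sum_comp_prodE a p : is_boolean_transform a p ->
  forall n, (fps_one K \+ fps_of_seq a) n = sum_comp_prod p n.
Proof.
move/boolean_transform_recurrence=> rec; elim/ltn_ind=> -[|n] IHn.
  by rewrite one_add_fps0 sum_comp_prod0.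
rewrite sum_comp_prodS /= {1}/fps_one add0r rec; apply: eq_bigr => k _.
by rewrite IHn // ltnS leq_subr.
Qed.

End Sums.

Theorem propositionA3 (K : fieldType) (a b p q r : nat -> K)
    (ap : is_boolean_transform a p) (bq : is_boolean_transform b q)
    (abr : is_boolean_transform (fun n => a n * b n) r)
    (n : nat) (n_gt0 : (0 < n)%N) :
  r n = \sum_(al : composition n)
          \sum_(be : composition n | parts (al `&` be)%O == [:: n])
             comp_prod p al * comp_prod q be.
Proof.
rewrite -/(sum_trivial_meet p q n).
apply: (boolean_transform_uniq abr) => //; apply/boolean_transform_recurrence.
have aE m : a m.+1 = sum_comp_prod p m.+1.
  by rewrite -(sum_comp_prodE ap) /= /fps_one add0r.
have bE m : b m.+1 = sum_comp_prod q m.+1.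
  by rewrite -(sum_comp_prodE bq) /= /fps_one add0r.
move=> m; rewrite aE bE sum_comp_prodM; apply: eq_bigr => k _; congr (_ * _).
case: (m - k)%N => [|j]; first by rewrite one_add_fps0 !sum_comp_prod0 mulr1.
by rewrite /= {1}/fps_one add0r aE bE.
Qed.
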